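(* Let $k$ be a field and let $V=k[t,t^{-1}]$. For every nonzero $\lambda\in k$, the product $$\{\!\{f,g\}\!\}_\lambda=\lambda\, y\,\frac{f(x)g(y)-g(x)f(y)}{y-x},\qquad f,g\in V,$$ makes $V$ into a simple $\lambda$-double Lie algebra.
   Context: $k$ is a field, $V=k[t,t^{-1}]$ is the space of Laurent polynomials, and $V\otimes V$ (tensor product over $k$) is identified with $k[x^{\pm1},y^{\pm1}]$ by $t^a\otimes t^b\leftrightarrow x^ay^b$ (so $x=t\otimes 1$, $y=1\otimes t$). Since $y-x$ divides $f(x)g(y)-g(x)f(y)$ in $k[x^{\pm1},y^{\pm1}]$, the quotient is understood as an element of $k[x^{\pm1},y^{\pm1}]=V\otimes V$. For a vector space $W$ over $k$, $u\in W^{\otimes n}$ and a permutation $\sigma$ of the tensor factors, $u^\sigma$ denotes the result of applying $\sigma$ to $u$ (e.g. $(a\otimes b\otimes c)^{(12)}=b\otimes a\otimes c$). Let $\lambda\in k$. A $\lambda$-double Lie algebra is a vector space $W$ over $k$ with a bilinear map $\{\!\{\cdot,\cdot\}\!\}\colon W\times W\to W\otimes W$ such that for all $a,b,c\in W$ $$\{\!\{a,b\}\!\}+\{\!\{b,a\}\!\}^{(12)}=\lambda(a\otimes b-b\otimes a),$$ $$\{\!\{a,\{\!\{b,c\}\!\}\}\!\}_L-\{\!\{b,\{\!\{a,c\}\!\}\}\!\}_R-\{\!\{\{\!\{a,b\}\!\},c\}\!\}_L=-\lambda\,(b\otimes\{\!\{a,c\}\!\})^{(12)},$$ where the actions on tensor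 products are determined (linearly) by $$\{\!\{a,u\otimes v\}\!\}_L=\{\!\{a,u\}\!\}\otimes v,\quad \{\!\{a,u\otimes v\}\!\}_R=u\otimes\{\!\{a,v\}\!\},\quad \{\!\{u\otimes v,a\}\!\}_L=(\{\!\{u,a\}\!\}\otimes v)^{(23)}.$$ A subspace $I\subseteq W$ is an ideal if $\{\!\{W,I\}\!\}+\{\!\{I,W\}\!\}\subseteq I\otimes W+W\otimes I$. A $\lambda$-double Lie algebra is simple if its double product is nonzero and its only ideals are $0$ and $W$. *)

(* Defs.v *)
From HB Require Import structures.
From mathcomp Require Import all_boot all_order all_algebra finmap monalg.
From mathcomp Require Import boolp classical_sets.

Set Implicit Arguments.
Unset Strict Implicit.
Unset Printing Implicit Defensive.

Import GRing.Theory.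
Local Open Scope fset_scope.
Local Open Scope classical_set_scope.
Local Open Scope ring_scope.

Definition bilinear (k : fieldType) (U W P : lmodType k) (B : U -> W -> P) :
    Prop :=
  bilinear_for *:%R *:%R B.

(* A tensor product of U and W, given by its universal property: [lift B] is  *)
(* the unique linear map sending u (x) w to B u w. [lift] takes a bare        *)
(* function, but is only specified when that function is bilinear.            *)
Record tensor (k : fieldType) (U W : lmodType k) := Tensor {
  tsort :> lmodType k;
  pure : U -> W -> tsort;
  lift : forall P : lmodType k, (U -> W -> P) -> tsort -> P;
  pure_bilinear : bilinear pure;
  lift_linear : forall (P : lmodType k) (B : U -> W -> P),
    bilinear B -> linear (lift B);
  lift_pure : forall (P : lmodType k) (B : U -> W -> P),
    bilinear B -> forall u w, lift B (pure u w) = B u w;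
  lift_unique : forall (P : lmodType k) (B : U -> W -> P) (L : tsort -> P),
    bilinear B -> linear L -> (forall u w, L (pure u w) = B u w) ->
    L =1 lift B
}.

Arguments pure {k U W} t u w.
Arguments lift {k U W} t {P} B h.

Section Subspaces.
Context (k : fieldType).

Definition subspace (W : lmodType k) (S : set W) : Prop :=
  S 0 /\ forall (a : k) (u v : W), S u -> S v -> S (a *: u + v).

Definition span (W : lmodType k) (S : set W) : set W := smallest (@subspace W) S.

Definition add_set (W : lmodType k) (S T : set W) : set W :=
  [set u + v | u in S & v in T].

(* The image of I (x) J in U (x) W. *)
Definition tensor_set (U W : lmodType k) (T : tensor U W)
    (I : set U) (J : set W) : set T :=
  span [set pure T u v | u in I & v in J].

End Subspaces.

Arguments tensor_set {k U W} T I J.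

Section DoubleLie.
Context (k : fieldType) (W : lmodType k).
(* W (x) W and W (x) W (x) W = (W (x) W) (x) W. *)
Context (T2 : tensor W W) (T3 : tensor T2 W).

Definition swap12_2 : T2 -> T2 := lift T2 (fun a b => pure T2 b a).

Definition swap12_3 : T3 -> T3 := lift T3 (fun s c => pure T3 (swap12_2 s) c).

Definition swap23_3 : T3 -> T3 :=
  lift T3 (fun s c => lift T2 (fun a b => pure T3 (pure T2 a c) b) s).

(* a (x) s, for s in W (x) W. *)
Definition pure_left (a : W) : T2 -> T3 :=
  lift T2 (fun b c => pure T3 (pure T2 a b) c).

Variable br : W -> W -> T2.

(* {{a, u (x) v}}_L = {{a, u}} (x) v *)
Definition br_L (a : W) : T2 -> T3 := lift T2 (fun u v => pure T3 (br a u) v).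

(* {{a, u (x) v}}_R = u (x) {{a, v}} *)
Definition br_R (a : W) : T2 -> T3 := lift T2 (fun u v => pure_left u (br a v)).

(* {{u (x) v, a}}_L = ({{u, a}} (x) v)^(23) *)
Definition tbr_L (s : T2) (a : W) : T3 :=
  lift T2 (fun u v => swap23_3 (pure T3 (br u a) v)) s.

Definition is_double_lie (lambda : k) : Prop :=
  [/\ bilinear br,
      forall a b : W,
        br a b + swap12_2 (br b a) = lambda *: (pure T2 a b - pure T2 b a)
    & forall a b c : W,
        br_L a (br b c) - br_R b (br a c) - tbr_L (br a b) c
        = - (lambda *: swap12_3 (pure_left b (br a c)))].

Definition br_set (I J : set W) : set T2 := span [set br u v | u in I & v in J].

Definition is_ideal (I : set W) : Prop :=
  subspace I /\
  add_set (br_set setT I) (br_set I setT)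
    `<=` add_set (tensor_set T2 I setT) (tensor_set T2 setT I).

Definition is_simple_double_lie (lambda : k) : Prop :=
  [/\ is_double_lie lambda,
      exists a b : W, br a b <> 0
    & forall I : set W, is_ideal I -> I = [set 0] \/ I = setT].

End DoubleLie.

(* The group algebra of the additive group G: finitely supported functions    *)
(* G -> k with the convolution product. [<< c *g a >>] is c times the         *)
(* monomial of exponent a. With G = int it is k[t^{+-1}], and with            *)
(* G = int * int it is k[x^{+-1}, y^{+-1}]. ([monalg] only puts a ring        *)
(* structure on {malg k[M]} for monoids M without nontrivial units.)          *)
Definition galg (k : fieldType) (G : zmodType) : Type := {malg k[G]}.

HB.instance Definition _ (k : fieldType) (G : zmodType) :=
  GRing.Lmodule.on (galg k G).

(* Locked because failed unifications otherwise unfold the convolution sums.  *)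
HB.lock Definition gmon (k : fieldType) (G : zmodType) (c : k) (a : G) :
    galg k G :=
  << c *g a >>.

HB.lock Definition gone (k : fieldType) (G : zmodType) : galg k G := gmon 1 0.

HB.lock Definition gmul (k : fieldType) (G : zmodType) (f g : galg k G) :
    galg k G :=
  \sum_(a <- msupp f) \sum_(b <- msupp g) gmon (f@_a * g@_b) (a + b).

Section GroupAlgebra.
Context (k : fieldType) (G : zmodType).
Implicit Types (f g h : galg k G).
Local Notation gmon := (@gmon k G).
Local Notation gmul := (@gmul k G).
Local Notation gone := (@gone k G).

Lemma mcoeff_gmon c a b : (gmon c a)@_b = c *+ (a == b).
Proof. by rewrite gmon.unlock mcoeffU. Qed.

Lemma msupp_gmon c a :
  msupp (gmon c a) = if c == 0 then fset0 else [fset a]%fset.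
Proof. by rewrite gmon.unlock msuppU. Qed.

Lemma msupp_gmon_le c a : (msupp (gmon c a) `<=` [fset a])%fset.
Proof. by rewrite gmon.unlock msuppU_le. Qed.

Lemma gmonD a : {morph (gmon^~ a) : c d / c + d}.
Proof. by move=> c d; rewrite gmon.unlock monalgUD. Qed.

Lemma gmon0 a : gmon 0 a = 0. Proof. by rewrite gmon.unlock monalgU0. Qed.

Lemma gmonZ c d a : c *: gmon d a = gmon (c * d) a.
Proof. by apply/malgP=> b; rewrite mcoeffZ !mcoeff_gmon mulrnAr. Qed.

Lemma galgE f : f = \sum_(a <- msupp f) gmon f@_a a.
Proof. by rewrite gmon.unlock -monalgE. Qed.

Lemma gmulw (d1 d2 : {fset G}) f g :
  (msupp f `<=` d1)%fset -> (msupp g `<=` d2)%fset ->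
  gmul f g = \sum_(a <- d1) \sum_(b <- d2) gmon (f@_a * g@_b) (a + b).
Proof.
move=> le1 le2; rewrite gmul.unlock (big_fset_incl _ le1) /=.
  apply/eq_bigr=> a _; apply/big_fset_incl => // b _ /mcoeff_outdom ->.
  by rewrite mulr0 gmon0.
move=> a _ /mcoeff_outdom fa.
by rewrite big1 // => b _; rewrite fa mul0r gmon0.
Qed.

Lemma gmulC : commutative gmul.
Proof.
move=> f g; rewrite gmul.unlock exchange_big /=.
by apply/eq_bigr=> b _; apply/eq_bigr=> a _; rewrite mulrC addrC.
Qed.

Lemma gmulDl : left_distributive gmul +%R.
Proof.
move=> f g h; pose d := (msupp f `|` msupp g)%fset.
have sh := fsubset_refl (msupp h).
rewrite (@gmulw d _ _ _ (msuppD_le _ _) sh).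
rewrite (@gmulw d _ _ _ (fsubsetUl _ _) sh) (@gmulw d _ _ _ (fsubsetUr _ _) sh).
rewrite -big_split; apply/eq_bigr=> a _ /=.
by rewrite -big_split; apply/eq_bigr=> b _ /=; rewrite mcoeffD mulrDl gmonD.
Qed.

Lemma gmulDr : right_distributive gmul +%R.
Proof. by move=> f g h; rewrite gmulC gmulDl !(gmulC _ f). Qed.

Lemma gmul0l : left_zero 0 gmul.
Proof. by move=> f; rewrite gmul.unlock msupp0 big_seq_fset0. Qed.

Lemma gmul0r : right_zero 0 gmul.
Proof. by move=> f; rewrite gmulC gmul0l. Qed.

Lemma gmulUU c d a b : gmul (gmon c a) (gmon d b) = gmon (c * d) (a + b).
Proof. by rewrite (gmulw (msupp_gmon_le _ _) (msupp_gmon_le _ _)) !big_seq_fset1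
  !mcoeff_gmon !eqxx. Qed.

Lemma gmul_suml (I : Type) (r : seq I) (F : I -> galg k G) g :
  gmul (\sum_(i <- r) F i) g = \sum_(i <- r) gmul (F i) g.
Proof. exact: (big_morph (gmul^~ g) (fun _ _ => gmulDl _ _ _) (gmul0l _)). Qed.

Lemma gmul_sumr (I : Type) (r : seq I) (F : I -> galg k G) g :
  gmul g (\sum_(i <- r) F i) = \sum_(i <- r) gmul g (F i).
Proof. exact: (big_morph (gmul g) (fun _ _ => gmulDr _ _ _) (gmul0r _)). Qed.

Lemma gmulA : associative gmul.
Proof.
move=> f g h; rewrite (galgE f) (galgE g) (galgE h).
rewrite !gmul_suml; apply/eq_bigr=> a _.
rewrite [LHS]gmul_sumr [X in _ = gmul X _]gmul_sumr gmul_suml.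
apply/eq_bigr=> b _.
rewrite !gmul_sumr; apply/eq_bigr=> c _.
by rewrite !gmulUU mulrA addrA.
Qed.

Lemma gmul1l : left_id gone gmul.
Proof.
move=> f; rewrite gone.unlock [in LHS](galgE f) [RHS]galgE gmul_sumr; apply/eq_bigr=> a _.
by rewrite gmulUU mul1r add0r.
Qed.

Lemma gone_neq0 : gone != 0.
Proof.
apply/eqP=> /malgP/(_ 0)/eqP.
by rewrite gone.unlock mcoeff_gmon eqxx mcoeff0 oner_eq0.
Qed.

HB.instance Definition _ := GRing.Zmodule_isComNzRing.Build (galg k G)
  gmulA gmulC gmul1l gmulDl gone_neq0.

Lemma galgMUU c d a b : gmon c a * gmon d b = gmon (c * d) (a + b).
Proof. exact: gmulUU. Qed.

Lemma gscaleAl c f g : c *: (f * g) = (c *: f) * g.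
Proof.
have sZ h : c *: h = gmon c 0 * h.
  rewrite [in LHS](galgE h) [in RHS](galgE h) mulr_sumr scaler_sumr.
  by apply/eq_bigr=> a _; rewrite gmonZ galgMUU add0r.
by rewrite !sZ mulrA.
Qed.

HB.instance Definition _ := GRing.Lmodule_isLalgebra.Build k (galg k G) gscaleAl.
HB.instance Definition _ := GRing.Lalgebra_isComAlgebra.Build k (galg k G).

End GroupAlgebra.

Section GroupAlgebraTensor.
Context (k : fieldType) (G H : zmodType).

Definition emb1 (f : galg k G) : galg k (G * H)%type :=
  \sum_(a <- msupp f) gmon f@_a (a, 0).

Definition emb2 (g : galg k H) : galg k (G * H)%type :=
  \sum_(b <- msupp g) gmon g@_b (0, b).

Definition galg_pure (f : galg k G) (g : galg k H) : galg k (G * H)%type :=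
  emb1 f * emb2 g.

Definition galg_lift (P : lmodType k) (B : galg k G -> galg k H -> P)
    (h : galg k (G * H)%type) : P :=
  \sum_(m <- msupp h) h@_m *: B (gmon 1 m.1) (gmon 1 m.2).

End GroupAlgebraTensor.

Section LinearExtension.
Context (k : fieldType) (G : zmodType) (P : lmodType k).
Implicit Type (e : G -> P) (f : galg k G).

Definition galg_ext e f : P := \sum_(a <- msupp f) f@_a *: e a.

Lemma galg_ext_linear e : linear (galg_ext e).
Proof.
have extw (d : {fset G}) f : (msupp f `<=` d)%fset ->
    galg_ext e f = \sum_(a <- d) f@_a *: e a.
  move=> le_d; apply: big_fset_incl => // a _ /mcoeff_outdom->.
  by rewrite scale0r.
move=> c f g; pose d := (msupp f `|` msupp g)%fset.
have sf : (msupp f `<=` d)%fset by exact: fsubsetUl.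
have sg : (msupp g `<=` d)%fset by exact: fsubsetUr.
have sc : (msupp ((c *: f : galg k G) + g) `<=` d)%fset.
  apply: fsubset_trans (msuppD_le _ _) _.
  exact/fsetSU/msuppZ_le.
rewrite (extw d f) // (extw d g) // (extw d _ sc) scaler_sumr -big_split /=.
by apply/eq_bigr=> a _; rewrite mcoeffD mcoeffZ scalerDl scalerA.
Qed.

Lemma galg_extU e c a : galg_ext e (gmon c a) = c *: e a.
Proof.
rewrite /galg_ext msupp_gmon; case: eqP => [->|_].
  by rewrite big_seq_fset0 scale0r.
by rewrite big_seq_fset1 mcoeff_gmon eqxx.
Qed.

Lemma linear_eqU (L L' : galg k G -> P) : linear L -> linear L' ->
  (forall a, L (gmon 1 a) = L' (gmon 1 a)) -> L =1 L'.
Proof.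
move=> lL lL' eqL f.
pose L1 := HB.pack_for {linear galg k G -> P} L
  (GRing.isLinear.Build k (galg k G) P _ L lL).
pose L2 := HB.pack_for {linear galg k G -> P} L'
  (GRing.isLinear.Build k (galg k G) P _ L' lL').
change (L1 f = L2 f); rewrite (galgE f) !linear_sum; apply/eq_bigr=> a _.
by rewrite -[f@_a]mulr1 -gmonZ !linearZ /= eqL.
Qed.

End LinearExtension.

Section GroupAlgebraTensorTheory.
Context (k : fieldType) (G H : zmodType).

Lemma emb1_linear : linear (@emb1 k G H).
Proof.
have E f : emb1 H f = galg_ext (fun a => gmon 1 (a, 0) : galg k _) f.
  by apply: eq_bigr => a _; rewrite gmonZ mulr1.
by move=> c f g; rewrite !E galg_ext_linear.
Qed.

Lemma emb2_linear : linear (@emb2 k G H).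
Proof.
have E f : emb2 G f = galg_ext (fun a => gmon 1 (0, a) : galg k _) f.
  by apply: eq_bigr => a _; rewrite gmonZ mulr1.
by move=> c f g; rewrite !E galg_ext_linear.
Qed.

Lemma emb1U c a : emb1 H (gmon c a : galg k G) = gmon c (a, 0).
Proof.
rewrite /emb1 msupp_gmon; case: eqP => [->|_]; first by rewrite big_seq_fset0 gmon0.
by rewrite big_seq_fset1 mcoeff_gmon eqxx.
Qed.

Lemma emb2U c a : emb2 G (gmon c a : galg k H) = gmon c (0, a).
Proof.
rewrite /emb2 msupp_gmon; case: eqP => [->|_]; first by rewrite big_seq_fset0 gmon0.
by rewrite big_seq_fset1 mcoeff_gmon eqxx.
Qed.

Lemma galg_pureU a b :
  galg_pure (gmon 1 a : galg k G) (gmon 1 b : galg k H) = gmon 1 (a, b).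
Proof.
rewrite /galg_pure emb1U emb2U galgMUU mulr1.
by congr gmon; congr pair; rewrite ?addr0 ?add0r.
Qed.

Lemma galg_pure_bilinear : bilinear (@galg_pure k G H).
Proof.
split=> [g c f f' | f c g g']; rewrite /galg_pure.
  by rewrite emb1_linear mulrDl -scalerAl.
by rewrite emb2_linear mulrDr -scalerAr.
Qed.

Lemma galg_lift_linear (P : lmodType k) (B : galg k G -> galg k H -> P) :
  bilinear B -> linear (galg_lift B).
Proof. by move=> _; apply: galg_ext_linear. Qed.

Lemma galg_liftU (P : lmodType k) (B : galg k G -> galg k H -> P) a b :
  galg_lift B (gmon 1 (a, b)) = B (gmon 1 a) (gmon 1 b).
Proof.
have := galg_extU (fun m : G * H => B (gmon 1 m.1) (gmon 1 m.2)) 1 (a, b).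
by rewrite scale1r.
Qed.

Lemma galg_lift_pure (P : lmodType k) (B : galg k G -> galg k H -> P) :
  bilinear B -> forall f g, galg_lift B (galg_pure f g) = B f g.
Proof.
move=> bB f g.
have lB := galg_lift_linear bB.
apply: (@linear_eqU _ _ _ (fun f => galg_lift B (galg_pure f g)) (B^~ g)).
- by move=> c u v; rewrite (galg_pure_bilinear.1 g) lB.
- exact: bB.1.
move=> a; apply: (@linear_eqU _ _ _
  (fun g => galg_lift B (galg_pure (gmon 1 a) g)) (B (gmon 1 a))).
- by move=> c u v; rewrite (galg_pure_bilinear.2 _) lB.
- exact: bB.2.
by move=> b; rewrite galg_pureU galg_liftU.
Qed.

Lemma galg_lift_unique (P : lmodType k) (B : galg k G -> galg k H -> P)
    (L : galg k (G * H)%type -> P) :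
  bilinear B -> linear L -> (forall f g, L (galg_pure f g) = B f g) ->
  L =1 galg_lift B.
Proof.
move=> bB lL LE; apply: linear_eqU => //; first exact: galg_lift_linear.
by case=> a b; rewrite galg_liftU -LE galg_pureU.
Qed.

(* k[G] (x) k[H] is k[G * H], with t^a (x) t^b the monomial of exponent       *)
(* (a, b).                                                                    *)
Definition galg_tensor : tensor (galg k G) (galg k H) :=
  Tensor galg_pure_bilinear galg_lift_linear galg_lift_pure galg_lift_unique.

End GroupAlgebraTensorTheory.

(* The quotient p / d, when it exists and is unique (see [laurent_br_dvd] *)
(* and [y_sub_x_reg] for the case used below); 0 when d does not divide p.    *)
Definition exact_quot (R : comNzRingType) (p d : R) : R :=
  xget 0 [set h | h * d = p].

Section Laurent.
Context (k : fieldType).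

Definition laurent : lmodType k := galg k int.

Definition laurent2 : tensor laurent laurent := galg_tensor k int int.

Definition laurent3 : tensor laurent2 laurent :=
  galg_tensor k (int * int)%type int.

Definition tvar : galg k int := gmon 1 1.

(* f(x) = f (x) 1 and g(y) = 1 (x) g. *)
Definition in_x (f : galg k int) : galg k (int * int)%type := emb1 int f.
Definition in_y (g : galg k int) : galg k (int * int)%type := emb2 int g.

Definition laurent_br (lambda : k) (f g : laurent) : laurent2 :=
  let x := in_x tvar in
  let y := in_y tvar in
  lambda *: (y * exact_quot (in_x f * in_y g - in_x g * in_y f) (y - x)).

End Laurent.

Lemma quot_step_id (R : comNzRingType) (x y a b : R) :
  y * (b - a) + a * (y - x) = y * b - x * a.
Proof. by rewrite !mulrBr [a * y]mulrC [a * x]mulrC addrA subrK. Qed.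

Lemma quot_antisym_id (R : comNzRingType) (a b c d : R) :
  a * (d - c) - c * (b - a) = a * d - c * b.
Proof. by rewrite !mulrBr opprB addrA [c * a]mulrC subrK. Qed.

Section LaurentQuotient.
Context (k : fieldType).
Local Notation x := (in_x (tvar k)).
Local Notation y := (in_y (tvar k)).
Implicit Types (f g : galg k int) (h : galg k (int * int)%type).

Lemma in_y_sub_in_x f : exists h, h * (y - x) = in_y f - in_x f.
Proof.
have X c n : in_x (gmon c n) = gmon c (n, 0) :> galg k _ by exact: emb1U.
have Y c n : in_y (gmon c n) = gmon c (0, n) :> galg k _ by exact: emb2U.
have pos (n : nat) : exists h, h * (y - x) = in_y (gmon 1 n%:Z) - in_x (gmon 1 n%:Z).
  elim: n => [|n [h hE]]; first by exists 0; rewrite mul0r X Y subrr.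
  exists (y * h + in_x (gmon 1 n%:Z)); rewrite mulrDl -mulrA hE.
  have -> : in_x (gmon 1 n.+1%:Z) = x * in_x (gmon 1 n%:Z) :> galg k _.
    by rewrite !X galgMUU mulr1 intS; congr gmon; congr pair; rewrite addr0.
  have -> : in_y (gmon 1 n.+1%:Z) = y * in_y (gmon 1 n%:Z) :> galg k _.
    by rewrite !Y galgMUU mulr1 intS; congr gmon; congr pair; rewrite addr0.
  exact: quot_step_id.
have mon n : exists h, h * (y - x) = in_y (gmon 1 n) - in_x (gmon 1 n).
  case: n => n; first exact: pos.
  have [h hE] := pos n.+1; rewrite NegzE.
  exists (- gmon 1 (- n.+1%:Z, - n.+1%:Z) * h); rewrite -mulrA hE !X !Y.
  rewrite mulrBr !mulNr !galgMUU mulr1 opprK addrC.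
  by congr (gmon _ _ - gmon _ _); congr pair; rewrite /= ?addr0 ?addNr.
rewrite (galgE f); elim: (enum_fset _) => [|n s [h hE]].
  have x0 : in_x (0 : galg k int) = 0 by rewrite -[X in in_x X](gmon0 k 0) X gmon0.
  have y0 : in_y (0 : galg k int) = 0 by rewrite -[X in in_y X](gmon0 k 0) Y gmon0.
  by exists 0; rewrite mul0r big_nil x0 y0 subrr.
have [h1 h1E] := mon n; exists (f@_n *: h1 + h).
rewrite big_cons -[f@_n in RHS]mulr1 -gmonZ /in_x /in_y emb1_linear emb2_linear.
rewrite mulrDl -scalerAl h1E hE scalerBr /in_x /in_y /=.
by rewrite opprD addrACA.
Qed.

Lemma laurent_br_dvd f g :
  exists h, h * (y - x) = in_x f * in_y g - in_x g * in_y f.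
Proof.
have [h hE] := in_y_sub_in_x g; have [h' h'E] := in_y_sub_in_x f.
exists (in_x f * h - in_x g * h').
by rewrite mulrBl -!mulrA hE h'E; exact: quot_antisym_id.
Qed.

Lemma y_sub_x_reg h : h * (y - x) = 0 -> h = 0.
Proof.
have cM (g : galg k (int * int)%type) m p : (g * gmon 1 m)@_p = g@_(p - m).
  rewrite [in LHS](galgE g) [in RHS](galgE g) mulr_suml !raddf_sum.
  apply: eq_bigr => a _; rewrite galgMUU mulr1 /= !mcoeff_gmon.
  by rewrite -(can2_eq (addrK m) (subrK m)).
rewrite mulrBr /in_x /in_y emb1U emb2U => /subr0_eq E.
have step a b : h@_(a, b) = h@_(a + 1, b - 1).
  have := congr1 (mcoeff (a + 1, b)) E; rewrite !cM /= => E1.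
  rewrite -[a in LHS](addrK 1) -[b in LHS]subr0 -E1.
  by congr (h@_(_, _)); rewrite subr0.
have steps (n : nat) a b : h@_(a, b) = h@_(a + n%:Z, b - n%:Z).
  elim: n => [|n IHn]; first by rewrite addr0 subr0.
  by rewrite IHn step -!addrA -opprD intS [1 + n%:Z]addrC.
apply/malgP=> -[a b]; rewrite mcoeff0; apply: contrapT => /eqP hab.
pose s := [seq (a + n%:Z, b - n%:Z) | n <- iota 0 (size (enum_fset (msupp h))).+1].
have us : uniq s by rewrite map_inj_uniq ?iota_uniq // => i j [] /addrI [].
have /(uniq_leq_size us) : {subset s <= enum_fset (msupp h)}.
  by move=> _ /mapP[n _ ->]; rewrite -[_ \in _]mcoeff_neq0 -steps.
by rewrite size_map size_iota ltnn.
Qed.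

Lemma laurent_brE (lambda : k) (f g : galg k int) :
  laurent_br lambda f g * (y - x)
  = lambda *: (y * (in_x f * in_y g - in_x g * in_y f)).
Proof.
rewrite /laurent_br -scalerAl -mulrA; congr (_ *: (_ * _)).
rewrite /exact_quot; case: xgetP => // /(_ _) H.
by have [h /H] := laurent_br_dvd f g.
Qed.

End LaurentQuotient.

(* Main.v *)
(* Axioms. Inside k[x1^{+-1}, x2^{+-1}, x3^{+-1}] each bracket becomes a      *)
(* fraction whose denominator is a product of differences xj - xi; these are  *)
(* regular, so clearing them turns both axioms into polynomial identities.    *)
(*                                                                            *)
(* Simplicity. Let I be a proper nonzero ideal and f in I, nonzero and        *)
(* supported on as short an interval {p, ..., p + d} as possible. If d > 0,   *)
(* then g = t^-1 (f - f_p t^p) is shorter than f, so g is not in I, and       *)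
(* likewise t^p is not in I + <t^{p+1}, ..., t^{p+d-1}>. Choose functionals   *)
(* phi, psi vanishing on I with psi(g) = 1, phi(t^p) = 1 and phi(t^a) = 0 for *)
(* p < a < p + d. Then phi (x) psi kills I (x) V + V (x) I but maps           *)
(* {{t^{p-1}, f}} to lambda psi(g) = lambda. So d = 0 and I contains some     *)
(* t^p. As {{t^{p-2}, t^p}} = lambda (t^{p-2} (x) t^p + t^{p-1} (x) t^{p-1}), *)
(* I contains t^{p-1}, and symmetrically t^{p+1}, hence everything.           *)
From HB Require Import structures.
From mathcomp Require Import all_boot all_order all_algebra finmap monalg.
From mathcomp Require Import boolp classical_sets ring zify.
Require Import Defs.

Set Implicit Arguments.
Unset Strict Implicit.
Unset Printing Implicit Defensive.

Import GRing.Theory.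
Local Open Scope ring_scope.

(** Multiplication by [y - x] is injective, so a bracket is determined by its product with [y - x],
    which is a polynomial expression ([laurent_br_unique]). Bilinearity and skew-symmetry are
    checked on these products. For the Jacobi identity every term is written in three variables as a
    quotient by a difference of coordinates ([br_L_quot], [br_R_quot], [tbr_L_quot]), and
    [jacobi_of_quotients] clears the denominators.

    For simplicity, if two functionals vanish on an ideal, their tensor product kills every bracket
    with an element of it ([pairing_ideal]). Functionals from [separating_functional], tested on the
    explicit sums of [laurent_brU], show that a nonzero ideal contains a monomial ([ideal_has_gmon])
    and then its neighbours ([ideal_gmon_step]), hence everything. *)

Lemma jacobi_of_quotients (R : comNzRingType)
    (l x1 x2 x3 a1 a2 a3 b1 b2 b3 c1 c2 c3 : R)
    (bc23 bc13 ac13 ac12 ab12 ab32 A B C : R) :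
  (forall h, h * ((x2 - x1) * (x3 - x2) * (x3 - x1)) = 0 -> h = 0) ->
  bc23 * (x3 - x2) = l * (x3 * (b2 * c3 - c2 * b3)) ->
  bc13 * (x3 - x1) = l * (x3 * (b1 * c3 - c1 * b3)) ->
  ac13 * (x3 - x1) = l * (x3 * (a1 * c3 - c1 * a3)) ->
  ac12 * (x2 - x1) = l * (x2 * (a1 * c2 - c1 * a2)) ->
  ab12 * (x2 - x1) = l * (x2 * (a1 * b2 - b1 * a2)) ->
  ab32 * (x2 - x3) = l * (x2 * (a3 * b2 - b3 * a2)) ->
  A * (x2 - x1) = l * (x2 * (a1 * bc23 - bc13 * a2)) ->
  B * (x3 - x2) = l * (x3 * (b2 * ac13 - ac12 * b3)) ->
  C * (x3 - x1) = l * (x3 * (ab12 * c3 - c1 * ab32)) ->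
  A - B - C = - (l * (b2 * ac13)).
Proof.
move=> reg bc23E bc13E ac13E ac12E ab12E ab32E AE BE CE.
apply/eqP; rewrite -subr_eq0; apply/eqP; apply: reg.
(* The factor [u * v * w] is consumed twice: first by the outer brackets, then by the inner ones. *)
pose u := x2 - x1; pose v := x3 - x2; pose w := x3 - x1.
transitivity ((A * u) * v * w - (B * v) * u * w - (C * w) * u * v
              + l * b2 * (ac13 * w) * u * v); first by rewrite /u /v /w; ring.
rewrite AE BE CE ac13E.
(* The denominator of [ab32] is [x2 - x3], that is [- v], whence the plus sign before [c1]. *)
transitivity (l * x2 * (a1 * (bc23 * v) * w - (bc13 * w) * v * a2)
  - l * x3 * (b2 * (ac13 * w) * u - (ac12 * u) * w * b3)
  - l * x3 * ((ab12 * u) * v * c3 + c1 * (ab32 * (x2 - x3)) * u)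
  + l * b2 * (l * (x3 * (a1 * c3 - c1 * a3))) * u * v).
  by rewrite /u /v /w; ring.
by rewrite bc23E bc13E ac13E ac12E ab12E ab32E /u /v /w; ring.
Qed.

(** * Functionals separating a vector from a subspace *)

Section Separation.
Context (k : fieldType) (W : lmodType k).
Local Open Scope classical_set_scope.

(** By Zorn, let M be maximal among the subspaces containing S and avoiding v. Maximality makes M a
    complement of the line spanned by v, and [phi] is the coordinate along v. *)
Lemma separating_functional (S : set W) (v : W) : subspace S -> ~ S v ->
  exists phi : W -> k^o,
    [/\ linear phi, forall u, S u -> phi u = 0 & phi v = 1].
Proof.
move=> subS Sv.
(* Zorn_bigcup requires the union of the empty chain to satisfy P. *)
pose P (M : set W) := M = set0 \/ [/\ subspace M, S `<=` M & ~ M v].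
have [|M [PM maxM]] := @Zorn_bigcup W P.
  move=> F FP totF.
  have [[X FX X0]|noX] := pselect (exists2 X, F X & X !=set0); last first.
    left; apply/seteqP; split=> // u [X FX Xu].
    by case: noX; exists X => //; exists u.
  have PX Y : F Y -> Y !=set0 -> [/\ subspace Y, S `<=` Y & ~ Y v].
    by move=> /FP[->|//] [].
  right; split; [split| |].
  - by exists X => //; have [[]] := PX X FX X0.
  - move=> a u w [Y FY Yu] [Z FZ Zw].
    have [_ YL] : subspace Y by have [] := PX Y FY (ex_intro _ _ Yu).
    have [_ ZL] : subspace Z by have [] := PX Z FZ (ex_intro _ _ Zw).
    have [YZ|ZY] := totF Y Z FY FZ.
      by exists Z => //; apply: ZL => //; exact: YZ.
    by exists Y => //; apply: YL => //; apply: ZY.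
  - by move=> u Su; exists X => //; have [_ SX _] := PX X FX X0; apply: SX.
  - by move=> [Y FY Yv]; have [] := PX Y FY (ex_intro _ _ Yv).
have [[M0 ML] SM Mv] : [/\ subspace M, S `<=` M & ~ M v].
  case: PM => // M0; exfalso; apply: (maxM S).
  by rewrite M0; split=> // /(_ 0 subS.1).
  by right; split.
have MD u w : M u -> M w -> M (u + w).
  by move=> Mu Mw; rewrite -[u]scale1r; apply: ML.
have MZ a u : M u -> M (a *: u) by move=> Mu; rewrite -[_ *: _]addr0; apply: ML.
have dec u : exists a : k, M (u - a *: v).
  have [Nv|Nv] := pselect (exists2 w, M w & exists a : k, w + a *: u = v).
    have [w Mw [a E]] := Nv.
    have a0 : a != 0.
      by apply: contra_notN Mv => /eqP a0; rewrite -E a0 scale0r addr0.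
    exists a^-1; rewrite -E scalerDr scalerA mulVf // scale1r opprD addrCA subrr.
    by rewrite addr0 -scaleN1r; apply/MZ/MZ.
  (* Here v lies outside M + k u, so maximality forces u into M. *)
  exists 0; rewrite scale0r subr0; apply: contrapT => Mu.
  pose Q := [set w + a *: u | w in M & a in [set: k]].
  have MQ : M `<=` Q.
    by move=> w Mw; exists w => //; exists 0 => //; rewrite scale0r addr0.
  apply: (maxM Q).
    split=> // /(_ u) QM; apply: Mu; apply: QM.
    by exists 0 => //; exists 1 => //; rewrite scale1r add0r.
  right; split; [split| |].
  - exact: MQ.
  - move=> c _ _ [w1 Mw1 [b1 _ <-]] [w2 Mw2 [b2 _ <-]].
    exists (c *: w1 + w2); first exact: ML.
    exists (c * b1 + b2) => //.
    by rewrite scalerDl scalerDr scalerA addrACA.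
  - exact: subset_trans MQ.
  - by move=> [w Mw [a _ E]]; apply: Nv; exists w => //; exists a.
have decU u a b : M (u - a *: v) -> M (u - b *: v) -> a = b.
  move=> Ma Mb; apply: contrapT => /eqP ab; apply: Mv.
  have := MD _ _ Ma (MZ (-1) _ Mb); rewrite scaleN1r opprB addrC addrA subrK.
  rewrite -scalerBl => /(MZ (b - a)^-1).
  by rewrite scalerA mulVf ?scale1r // subr_eq0 eq_sym.
have [phi phiP] := choice dec.
exists phi; split.
- move=> c u w; apply: (decU (c *: u + w)) => //.
  rewrite scalerDl opprD addrACA -scalerA -scalerBr.
  exact: ML.
- by move=> u Su; apply: (decU u) => //; rewrite scale0r subr0; apply: SM.
- by apply: (decU v) => //; rewrite scale1r subrr.
Qed.

End Separation.

(* Locked so that failed unifications do not unfold it. *)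
HB.lock Definition galg_map (k : fieldType) (G H : zmodType) (phi : G -> H)
    (f : galg k G) : galg k H :=
  \sum_(a <- msupp f) gmon f@_a (phi a).

(** * Substitutions in group algebras *)

Section GalgMap.
Context (k : fieldType) (G H : zmodType).
Local Notation galg_map := (@galg_map k G H).

Lemma galg_mapE phi f :
  galg_map phi f = galg_ext (fun a => gmon 1 (phi a) : galg k H) f.
Proof.
by rewrite galg_map.unlock; apply: eq_bigr => a _; rewrite gmonZ mulr1.
Qed.

Lemma galg_map_linear phi : linear (galg_map phi).
Proof. by move=> c u v; rewrite !galg_mapE; exact: galg_ext_linear. Qed.

HB.instance Definition _ phi :=
  GRing.isLinear.Build k (galg k G) (galg k H) _ (galg_map phi)
    (galg_map_linear phi).

Lemma galg_mapU phi c a : galg_map phi (gmon c a) = gmon c (phi a).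
Proof. by rewrite galg_mapE galg_extU gmonZ mulr1. Qed.

Lemma galg_mapM phi : {morph phi : a b / a + b} ->
  {morph galg_map phi : f g / f * g}.
Proof.
move=> phiD f g; rewrite (galgE f) (galgE g) mulr_suml !linear_sum mulr_suml.
apply: eq_bigr => a _; rewrite mulr_sumr !linear_sum mulr_sumr.
by apply: eq_bigr => b _; rewrite /= galgMUU !galg_mapU galgMUU phiD.
Qed.

End GalgMap.

Lemma galg_map_comp (k : fieldType) (G1 G2 G3 : zmodType) (phi : G2 -> G3)
    (psi : G1 -> G2) (f : galg k G1) :
  galg_map phi (galg_map psi f) = galg_map (phi \o psi) f.
Proof.
apply: (linear_eqU (L := galg_map phi \o galg_map psi)) f => [c u v|c u v|a].
- by rewrite /= !linearP.
- by rewrite linearP.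
- by rewrite /= !galg_mapU.
Qed.

Section Monomials.
Context (k : fieldType) (G : zmodType).

Lemma eq_linear_msupp (P : lmodType k) (L L' : galg k G -> P) (f : galg k G) :
  linear L -> linear L' ->
  (forall a, f@_a != 0 -> L (gmon 1 a) = L' (gmon 1 a)) -> L f = L' f.
Proof.
move=> lL lL' E.
pose F := HB.pack_for {linear galg k G -> P} L
  (GRing.isLinear.Build k (galg k G) P _ L lL).
pose F' := HB.pack_for {linear galg k G -> P} L'
  (GRing.isLinear.Build k (galg k G) P _ L' lL').
change (F f = F' f); rewrite (galgE f) !linear_sum.
apply: eq_big_seq => a; rewrite -[_ \in _]mcoeff_neq0 => /E Ea.
by rewrite -[f@_a]mulr1 -gmonZ !linearZ /= Ea.
Qed.

Lemma galg_scaleE c (h : galg k G) : c *: h = gmon c 0 * h.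
Proof.
rewrite [in LHS](galgE h) [in RHS](galgE h) mulr_sumr scaler_sumr.
by apply/eq_bigr=> a _; rewrite gmonZ galgMUU add0r.
Qed.

Lemma mcoeff_mul_gmon (h : galg k G) m p : (h * gmon 1 m)@_p = h@_(p - m).
Proof.
rewrite [in LHS](galgE h) [in RHS](galgE h) mulr_suml !raddf_sum.
apply: eq_bigr => a _; rewrite galgMUU mulr1 /= !mcoeff_gmon.
by rewrite -(can2_eq (addrK m) (subrK m)).
Qed.

(** If the product vanishes, the coefficients of h are constant along translates by [m - m']. These
    are infinitely many, while the support is finite. *)
Lemma gmon_sub_reg (m m' : G) : injective (fun n : nat => (m - m') *+ n) ->
  forall h : galg k G, h * (gmon 1 m - gmon 1 m') = 0 -> h = 0.
Proof.
move=> inj h; rewrite mulrBr => /subr0_eq E.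
have step p : h@_p = h@_(p + (m - m')).
  by rewrite -[p in LHS](addrK m) -mcoeff_mul_gmon E mcoeff_mul_gmon addrA.
have steps (n : nat) p : h@_p = h@_(p + (m - m') *+ n).
  elim: n => [|n IHn]; first by rewrite mulr0n addr0.
  by rewrite IHn step -addrA mulrSr.
apply/malgP=> p; rewrite mcoeff0; apply: contrapT => /eqP hp.
pose s := [seq p + (m - m') *+ n | n <- iota 0 (size (enum_fset (msupp h))).+1].
have us : uniq s by rewrite map_inj_uniq ?iota_uniq // => i j /addrI /inj.
have /(uniq_leq_size us) : {subset s <= enum_fset (msupp h)}.
  by move=> _ /mapP[n _ ->]; rewrite -[_ \in _]mcoeff_neq0 -steps.
by rewrite size_map size_iota ltnn.
Qed.

End Monomials.

Section LaurentBracket.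
Context (k : fieldType) (lambda : k).
Local Notation A1 := (galg k int).
Local Notation A2 := (galg k (int * int)%type).
Local Notation A3 := (galg k ((int * int) * int)%type).
Local Notation x := (in_x (tvar k)).
Local Notation y := (in_y (tvar k)).
Local Notation br := (@laurent_br k lambda : A1 -> A1 -> A2).

(** * Bilinearity and skew-symmetry *)

Lemma in_xE f : in_x f = galg_map (fun a => (a, 0)) f :> A2.
Proof. by rewrite galg_map.unlock. Qed.

Lemma in_yE f : in_y f = galg_map (fun a => (0, a)) f :> A2.
Proof. by rewrite galg_map.unlock. Qed.

Lemma laurent_br_unique (f g : A1) (h : A2) :
  h * (y - x) = lambda *: (y * (in_x f * in_y g - in_x g * in_y f)) ->
  br f g = h.
Proof.
rewrite -laurent_brE => E.
by apply/subr0_eq/y_sub_x_reg; rewrite mulrBl E subrr.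
Qed.

Lemma in_xP c (f g : A1) : in_x (c *: f + g) = gmon c 0 * in_x f + in_x g.
Proof. by rewrite /in_x emb1_linear galg_scaleE. Qed.

Lemma in_yP c (f g : A1) : in_y (c *: f + g) = gmon c 0 * in_y f + in_y g.
Proof. by rewrite /in_y emb2_linear galg_scaleE. Qed.

Lemma laurent_br_bilinear : bilinear br.
Proof.
split=> [g c f f'|f c g g'] /=; apply: laurent_br_unique;
  rewrite ?in_xP ?in_yP mulrDl !galg_scaleE -mulrA.
- have := laurent_brE lambda f g; have := laurent_brE lambda f' g.
  move: (laurent_br _ f g) (laurent_br _ f' g) => D D' -> ->.
  by rewrite !galg_scaleE; ring.
- have := laurent_brE lambda f g; have := laurent_brE lambda f g'.
  move: (laurent_br _ f g) (laurent_br _ f g') => D D' -> ->.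
  by rewrite !galg_scaleE; ring.
Qed.

Definition swap2 : A2 -> A2 := galg_map (fun m => (m.2, m.1)).

Lemma swap12_2E : @swap12_2 k (laurent k) (laurent2 k) =1 swap2.
Proof.
apply: linear_eqU; [exact: galg_ext_linear|exact: galg_map_linear|case=> a b].
rewrite /swap2 galg_mapU; apply: etrans (galg_liftU _ a b) _.
exact: galg_pureU.
Qed.

Lemma swap2_x f : swap2 (in_x f) = in_y f.
Proof. by rewrite in_xE in_yE /swap2 galg_map_comp. Qed.

Lemma swap2_y f : swap2 (in_y f) = in_x f.
Proof. by rewrite in_xE in_yE /swap2 galg_map_comp. Qed.

(** After multiplication by [y - x] the two brackets contribute the same antisymmetric expression
    with factors y and - x; their sum restores [y - x]. *)
Lemma laurent_br_antisym (f g : A1) :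
  br f g + swap2 (br g f) = lambda *: (in_x f * in_y g - in_x g * in_y f).
Proof.
have sM : {morph swap2 : u v / u * v} by apply: galg_mapM.
apply/subr0_eq/y_sub_x_reg.
have := congr1 swap2 (laurent_brE lambda g f); have := laurent_brE lambda f g.
move: (laurent_br _ f g) (laurent_br _ g f) => D D' E.
rewrite !galg_scaleE !sM /swap2 !linearB /= -/swap2 !sM !swap2_x !swap2_y.
rewrite {2}/swap2 galg_mapU /= => E'.
transitivity (D * (y - x) - swap2 D' * (x - y)
  - (gmon lambda 0 * (in_x f * in_y g - in_x g * in_y f)) * (y - x)).
  by ring.
by rewrite E E' !galg_scaleE; ring.
Qed.

(** An additive map of exponents induces a ring morphism, which carries the defining equation of the
    quotient to any pair of coordinates. *)
Lemma galg_map_br (H : zmodType) (phi : int * int -> H) (f g : A1) :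
  {morph phi : a b / a + b} ->
  let F1 := galg_map (fun a => phi (a, 0)) in
  let F2 := galg_map (fun a => phi (0, a)) in
  galg_map phi (br f g) * (F2 (tvar k) - F1 (tvar k))
  = gmon lambda 0 * (F2 (tvar k) * (F1 f * F2 g - F1 g * F2 f)).
Proof.
move=> phiD F1 F2.
have phi0 : phi 0 = 0 by apply: (addrI (phi 0)); rewrite -phiD !addr0.
have M := galg_mapM (k := k) phiD.
have E1 u : galg_map phi (in_x u) = F1 u by rewrite in_xE galg_map_comp.
have E2 u : galg_map phi (in_y u) = F2 u by rewrite in_yE galg_map_comp.
rewrite -!E1 -!E2 -phi0 -(galg_mapU phi lambda 0) -!M -!linearB -!M.
by have := laurent_brE lambda f g; rewrite galg_scaleE => <-; rewrite M.
Qed.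

(* [Xi f] is f(xi) and [eij s] is s(xi, xj). *)
Local Notation X1 :=
  (galg_map (k := k) (fun a : int => ((a, 0 : int), 0 : int))).
Local Notation X2 :=
  (galg_map (k := k) (fun a : int => ((0 : int, a), 0 : int))).
Local Notation X3 :=
  (galg_map (k := k) (fun a : int => ((0 : int, 0 : int), a))).
Local Notation e12 := (galg_map (k := k) (fun m : int * int => (m, 0 : int))).
Local Notation e13 :=
  (galg_map (k := k) (fun m : int * int => ((m.1, 0 : int), m.2))).
Local Notation e23 :=
  (galg_map (k := k) (fun m : int * int => ((0 : int, m.1), m.2))).
Local Notation e32 :=
  (galg_map (k := k) (fun m : int * int => ((0 : int, m.2), m.1))).
Local Notation t := (tvar k).

(** * The Jacobi identity in three variables *)

Lemma e12_br f g : e12 (br f g) * (X2 t - X1 t)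
  = gmon lambda 0 * (X2 t * (X1 f * X2 g - X1 g * X2 f)).
Proof. by apply: galg_map_br => a b; congr pair; rewrite addr0. Qed.

Lemma e13_br f g : e13 (br f g) * (X3 t - X1 t)
  = gmon lambda 0 * (X3 t * (X1 f * X3 g - X1 g * X3 f)).
Proof. by apply: galg_map_br => a b; congr (_, _, _); rewrite addr0. Qed.

Lemma e23_br f g : e23 (br f g) * (X3 t - X2 t)
  = gmon lambda 0 * (X3 t * (X2 f * X3 g - X2 g * X3 f)).
Proof. by apply: galg_map_br => a b; congr (_, _, _); rewrite addr0. Qed.

Lemma e32_br f g : e32 (br f g) * (X2 t - X3 t)
  = gmon lambda 0 * (X2 t * (X3 f * X2 g - X3 g * X2 f)).
Proof. by apply: galg_map_br => a b; congr (_, _, _); rewrite addr0. Qed.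

Local Notation T3 := (laurent3 k).

Lemma laurent3_pureE (s : A2) (v : A1) : pure T3 s v = e12 s * X3 v :> A3.
Proof. by rewrite !galg_map.unlock. Qed.

Lemma laurent2_pureE (f g : A1) : pure (laurent2 k) f g = in_x f * in_y g :> A2.
Proof. by []. Qed.

Lemma e12_in_xM f g : e12 (in_x f * in_y g) = X1 f * X2 g.
Proof.
have M : {morph e12 : u v / u * v}.
  by apply: galg_mapM => a b; congr pair; rewrite addr0.
by rewrite M in_xE in_yE !galg_map_comp.
Qed.

Lemma pure_leftE a (s : A2) : @pure_left k _ _ T3 a s = X1 a * e23 s :> A3.
Proof.
move: s; apply: linear_eqU; first exact: galg_ext_linear.
  by move=> c u v; rewrite galg_map_linear !galg_scaleE; ring.
case=> m n; apply: etrans (galg_liftU _ m n) _.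
rewrite laurent3_pureE laurent2_pureE e12_in_xM -mulrA !galg_mapU galgMUU mulr1.
by congr (_ * gmon _ _); congr (_, _, _); rewrite /= ?addr0 ?add0r.
Qed.

Lemma swap23_3E (s : A3) : @swap23_3 k _ _ T3 s
  = galg_map (fun m : (int * int) * int => ((m.1.1, m.2), m.1.2)) s :> A3.
Proof.
move: s; apply: linear_eqU; [exact: galg_ext_linear|exact: galg_map_linear|].
case=> -[a b] c; rewrite galg_mapU.
apply: etrans (galg_liftU _ (a, b) c) _; apply: etrans (galg_liftU _ a b) _.
rewrite laurent3_pureE laurent2_pureE e12_in_xM !galg_mapU !galgMUU !mulr1.
by congr gmon; congr (_, _, _); rewrite /= ?addr0 ?add0r.
Qed.

Lemma swap12_3E (s : A3) : @swap12_3 k _ _ T3 s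
  = galg_map (fun m : (int * int) * int => ((m.1.2, m.1.1), m.2)) s :> A3.
Proof.
move: s; apply: linear_eqU; [exact: galg_ext_linear|exact: galg_map_linear|].
case=> -[a b] c; rewrite galg_mapU.
apply: etrans (galg_liftU _ (a, b) c) _.
rewrite laurent3_pureE swap12_2E /swap2 !galg_mapU !galgMUU !mulr1.
by congr gmon; congr (_, _, _); rewrite /= ?addr0 ?add0r.
Qed.

Lemma e23U m n : e23 (gmon 1 (m, n)) = X2 (gmon 1 m) * X3 (gmon 1 n).
Proof.
rewrite !galg_mapU galgMUU mulr1.
by congr gmon; congr (_, _, _); rewrite /= ?addr0 ?add0r.
Qed.

Lemma e13U m n : e13 (gmon 1 (m, n)) = X1 (gmon 1 m) * X3 (gmon 1 n).
Proof.
rewrite !galg_mapU galgMUU mulr1.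
by congr gmon; congr (_, _, _); rewrite /= ?addr0 ?add0r.
Qed.

Lemma e12U m n : e12 (gmon 1 (m, n)) = X1 (gmon 1 m) * X2 (gmon 1 n).
Proof.
rewrite !galg_mapU galgMUU mulr1.
by congr gmon; congr (_, _, _); rewrite /= ?addr0 ?add0r.
Qed.

Lemma e32U m n : e32 (gmon 1 (m, n)) = X3 (gmon 1 m) * X2 (gmon 1 n).
Proof.
rewrite !galg_mapU galgMUU mulr1.
by congr gmon; congr (_, _, _); rewrite /= ?addr0 ?add0r.
Qed.

(** By linearity s may be a monomial: its second factor stays in x3, while the bracket evaluates its
    first factor at x2 and at x1, which gives [e23 s] and [e13 s]. *)
Lemma br_L_quot a (s : A2) : @br_L k _ _ T3 br a s * (X2 t - X1 t)
  = gmon lambda 0 * (X2 t * (X1 a * e23 s - e13 s * X2 a)).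
Proof.
have : linear (@br_L k _ _ T3 br a : A2 -> A3) by exact: galg_ext_linear.
have : forall m n, @br_L k _ _ T3 br a (gmon 1 (m, n))
    = e12 (br a (gmon 1 m)) * X3 (gmon 1 n).
  by move=> m n; rewrite -laurent3_pureE; exact: galg_liftU.
move: (@br_L k _ _ T3 br a) => F FU FL; move: s; apply: linear_eqU.
- by move=> c u v; rewrite FL !galg_scaleE; ring.
- by move=> c u v; rewrite !galg_map_linear !galg_scaleE; ring.
case=> m n; rewrite FU mulrAC e12_br e23U e13U; ring.
Qed.

Lemma br_R_quot b (s : A2) : @br_R k _ _ T3 br b s * (X3 t - X2 t)
  = gmon lambda 0 * (X3 t * (X2 b * e13 s - e12 s * X3 b)).
Proof.
have : linear (@br_R k _ _ T3 br b : A2 -> A3) by exact: galg_ext_linear.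
have : forall m n, @br_R k _ _ T3 br b (gmon 1 (m, n))
    = X1 (gmon 1 m) * e23 (br b (gmon 1 n)).
  by move=> m n; rewrite -pure_leftE; exact: galg_liftU.
move: (@br_R k _ _ T3 br b) => F FU FL; move: s; apply: linear_eqU.
- by move=> c u v; rewrite FL !galg_scaleE; ring.
- by move=> c u v; rewrite !galg_map_linear !galg_scaleE; ring.
case=> m n; rewrite FU -mulrA e23_br e12U e13U; ring.
Qed.

(** The permutation (23) puts the bracket in x1, x3 and the second factor of s in x2. Evaluating the
    first factor at x3 therefore produces the reversed [e32 s]. *)
Lemma tbr_L_quot (s : A2) c : @tbr_L k _ _ T3 br s c * (X3 t - X1 t)
  = gmon lambda 0 * (X3 t * (e12 s * X3 c - X1 c * e32 s)).
Proof.
pose F (s : A2) : A3 := @tbr_L k _ _ T3 br s c; rewrite -/(F s).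
have : linear F by exact: galg_ext_linear.
have : forall m n, F (gmon 1 (m, n)) = e13 (br (gmon 1 m) c) * X2 (gmon 1 n).
  move=> m n; apply: etrans (galg_liftU _ m n) _.
  by rewrite swap23_3E laurent3_pureE galg_mapM ?galg_map_comp.
move: F => F FU FL; move: s; apply: linear_eqU.
- by move=> d u v; rewrite FL !galg_scaleE; ring.
- by move=> d u v; rewrite !galg_map_linear !galg_scaleE; ring.
case=> m n; rewrite FU mulrAC e13_br e12U e32U; ring.
Qed.

Lemma swap12_leftE b (s : A2) :
  @swap12_3 k _ _ T3 (@pure_left k _ _ T3 b s) = X2 b * e13 s.
Proof. by rewrite swap12_3E pure_leftE galg_mapM // !galg_map_comp. Qed.

Lemma coordinate_differences_reg (h : A3) :
  h * ((X2 t - X1 t) * (X3 t - X2 t) * (X3 t - X1 t)) = 0 -> h = 0.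
Proof.
have inj (pi : {additive ((int * int) * int)%type -> int}) m :
    pi m = 1 -> injective (fun n : nat => m *+ n).
  move=> pi1 i j /(congr1 pi); rewrite !raddfMn pi1 => /eqP.
  by rewrite Num.Theory.eqr_nat => /eqP.
rewrite !mulrA /tvar !galg_mapU => E.
apply: (gmon_sub_reg (inj (snd \o fst) _ _)) (gmon_sub_reg (inj snd _ _)
  (gmon_sub_reg (inj snd _ _) E)) => //.
Qed.

Lemma laurent_br_jacobi a b c :
  @br_L k _ _ T3 br a (br b c) - @br_R k _ _ T3 br b (br a c)
    - @tbr_L k _ _ T3 br (br a b) c
  = - (lambda *: @swap12_3 k _ _ T3 (@pure_left k _ _ T3 b (br a c))).
Proof.
rewrite swap12_leftE galg_scaleE.
apply: (jacobi_of_quotients coordinate_differences_reg (e23_br b c) (e13_br b c)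
  (e13_br a c) (e12_br a c) (e12_br a b) (e32_br a b)).
- exact: br_L_quot.
- exact: br_R_quot.
- exact: tbr_L_quot.
Qed.

(** This is the geometric sum for (y^j - x^j) / (y - x), times x^n y^(n+1); the proof telescopes. *)
Lemma laurent_brU (n : int) (j : nat) : br (gmon 1 n) (gmon 1 (n + j%:Z))
  = lambda *: \sum_(0 <= i < j) gmon 1 (n + i%:Z, n + (j%:Z - i%:Z)).
Proof.
apply: laurent_br_unique; rewrite -scalerAl; congr (_ *: _).
pose T (i : nat) : A2 := gmon 1 (n + i%:Z, n + (j%:Z - i%:Z) + 1).
have -> : y * (in_x (gmon 1 n) * in_y (gmon 1 (n + j%:Z))
    - in_x (gmon 1 (n + j%:Z)) * in_y (gmon 1 n)) = T 0%N - T j.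
  rewrite /in_x /in_y !emb1U !emb2U mulrBr !mulrA !galgMUU !mulr1 /T.
  by congr (gmon 1 _ - gmon 1 _); congr pair => /=; lia.
rewrite -[RHS]opprB -telescope_sumr // mulr_suml -sumrN.
apply: eq_bigr => i _.
rewrite /in_x /in_y emb1U emb2U opprB mulrBr !galgMUU !mulr1 /T.
by congr (gmon 1 _ - gmon 1 _); congr pair => /=; lia.
Qed.

(** * Pairing brackets with functionals *)

Section Pairing.
Context (phi psi : A1 -> k^o).
Hypotheses (phi_lin : linear phi) (psi_lin : linear psi).

Definition pairing : A2 -> k^o :=
  lift (laurent2 k) (fun u v => phi u * psi v : k^o).

Lemma pairing_linear : linear pairing.
Proof. exact: galg_ext_linear. Qed.

HB.instance Definition _ :=
  GRing.isLinear.Build k A2 k^o _ pairing pairing_linear.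

Lemma pairingU a b : pairing (gmon 1 (a, b)) = phi (gmon 1 a) * psi (gmon 1 b).
Proof. exact: galg_liftU. Qed.

Lemma pairing_pure f g : pairing (pure (laurent2 k) f g) = phi f * psi g.
Proof.
apply: galg_lift_pure; split=> [v c u w|u c v w].
  by rewrite phi_lin mulrDl -scalerAl.
by rewrite psi_lin mulrDr -scalerAr.
Qed.

Lemma pairing_laurent_brU (n : int) (j : nat) :
  pairing (br (gmon 1 n) (gmon 1 (n + j%:Z)))
  = lambda * \sum_(0 <= i < j)
      phi (gmon 1 (n + i%:Z)) * psi (gmon 1 (n + (j%:Z - i%:Z))).
Proof.
rewrite laurent_brU linearZ linear_sum; congr (_ * _).
by apply: eq_bigr => i _; rewrite /= pairingU.
Qed.

Lemma pairing_ideal (I : set A1) f g : is_ideal (T2 := laurent2 k) br I ->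
  (forall u, I u -> phi u = 0) -> (forall u, I u -> psi u = 0) ->
  I g -> pairing (br f g) = 0 /\ pairing (br g f) = 0.
Proof.
move=> [_ idI] phiI psiI Ig.
pose K : set A2 := [set h | pairing h = 0]%classic.
have subK : subspace (k := k) K.
  split; first by rewrite /K /= linear0.
  by move=> c u v; rewrite /K /= linearP /= => -> ->; rewrite scaler0 addr0.
have sub h : add_set (tensor_set (laurent2 k) I setT)
    (tensor_set (laurent2 k) setT I) h -> K h.
  move=> [u Ku [v Kv <-]]; rewrite -[u]scale1r; apply: subK.2.
    apply: (Ku K); split=> // _ [u' Iu' [v' _ <-]].
    by rewrite /K /= pairing_pure phiI // mul0r.
  apply: (Kv K); split=> // _ [u' _ [v' Iv' <-]].
  by rewrite /K /= pairing_pure psiI // mulr0.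
have span0 (A : set A2) : span (k := k) A 0 by move=> S [[]].
have spanI (A : set A2) u : A u -> span (k := k) A u by move=> Au S [_]; apply.
split; apply/sub/idI.
  exists (br f g); first by apply: spanI; exists f => //; exists g.
  by exists 0; [exact: span0|rewrite addr0].
exists 0; first exact: span0.
exists (br g f); last by rewrite add0r.
by apply: spanI; exists g => //; exists f.
Qed.

End Pairing.

(** * Nonzero ideals *)

Section Ideal.
Context (I : set A1).
Hypothesis (idI : is_ideal (T2 := laurent2 k) br I) (lambda0 : lambda != 0).

Lemma idealZ c u : I u -> I (c *: u).
Proof.
by move=> Iu; rewrite -[_ *: _]addr0; apply: idI.1.2 => //; apply: idI.1.1.
Qed.

(** Otherwise take [phi] vanishing on I with value 1 at t^c. The bracket of t^(c-1) and t^(c+1), one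
    of which is t^p, has a term killed by [phi] at t^p and the term t^c (x) t^c; it pairs to
    [lambda], yet must pair to 0. *)
Lemma ideal_gmon_step (p c : int) :
  c = p + 1 \/ c = p - 1 -> I (gmon 1 p) -> I (gmon 1 c).
Proof.
move=> cE Ip; apply: contrapT => nI.
have [phi [philin phiI phi1]] := separating_functional idI.1 nI.
have [n [nE br0]] : exists n : int, n + 1 = c /\
    pairing phi phi (br (gmon 1 n) (gmon 1 (n + 2%:Z))) = 0.
  case: cE => ->.
    exists p; split => //.
    exact: (pairing_ideal philin philin (gmon 1 (p + 2%:Z)) idI phiI phiI Ip).2.
  exists (p - 2); split; first by lia.
  rewrite (_ : p - 2 + 2%:Z = p); last by lia.
  exact: (pairing_ideal philin philin (gmon 1 (p - 2)) idI phiI phiI Ip).1.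
move: br0; rewrite pairing_laurent_brU big_nat_recr //= big_nat1 addr0 subr0 nE.
have -> : phi (gmon 1 n) * phi (gmon 1 (n + 2%:Z)) = 0.
  case: cE => cE.
    have -> : n = p by lia.
    by rewrite (phiI _ Ip) mul0r.
  have -> : n + 2%:Z = p by lia.
  by rewrite (phiI _ Ip) mulr0.
by move/eqP; rewrite phi1 add0r !mulr1 (negPf lambda0).
Qed.

Lemma ideal_full (p : int) : I (gmon 1 p) -> I = setT.
Proof.
move=> Ip.
have Iup (n : nat) : I (gmon 1 (p + n%:Z)).
  elim: n => [|n IHn]; first by rewrite addr0.
  by apply: ideal_gmon_step IHn; left; lia.
have Idown (n : nat) : I (gmon 1 (p - n%:Z)).
  elim: n => [|n IHn]; first by rewrite subr0.
  by apply: ideal_gmon_step IHn; right; lia.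
have Iall a : I (gmon 1 a).
  have [pa|ap] := Order.TotalTheory.leP p a.
    by rewrite (_ : a = p + `|a - p|%N%:Z); [exact: Iup|lia].
  by rewrite (_ : a = p - `|p - a|%N%:Z); [exact: Idown|lia].
apply/seteqP; split=> // f _; rewrite (galgE f).
elim: (enum_fset _) => [|a s IHs]; first by rewrite big_nil; exact: idI.1.1.
by rewrite big_cons -[f@_a]mulr1 -gmonZ; apply: idI.1.2.
Qed.

Lemma ideal_has_gmon (d : nat) (p : int) (f : A1) : I f -> f != 0 ->
  (forall a, f@_a != 0 -> p <= a < p + d%:Z) -> exists a, I (gmon 1 a).
Proof.
elim: d p f => [|d IHd] p f If f0 supp.
  case/eqP: f0; apply/malgP => a; rewrite mcoeff0; apply/eqP/contraT => /supp.
  by lia.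
(* [shift f] drops the term at p and divides by t, which shortens the window of f by one. *)
pose shift (h : A1) : A1 := gmon 1 (- 1) * (h - gmon h@_p p).
have shiftE h a : (shift h)@_a = if a == p - 1 then 0 else h@_(a + 1).
  rewrite /shift mulrC mcoeff_mul_gmon opprK mcoeffB mcoeff_gmon.
  have [->|ap] := eqVneq a (p - 1); first by rewrite subrK eqxx subrr.
  by rewrite (_ : p == a + 1 = false) ?subr0 //; lia.
have shiftU a : shift (gmon 1 a) = if a == p then 0 else gmon 1 (a - 1).
  rewrite /shift mcoeff_gmon.
  have [->|_] := eqVneq a p; first by rewrite subrr mulr0.
  by rewrite gmon0 subr0 galgMUU mulr1 addrC.
have shift_lin : linear shift.
  move=> c u v; apply/malgP => a.
  rewrite mcoeffD mcoeffZ !shiftE mcoeffD mcoeffZ.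
  by have [_|_] := eqVneq a (p - 1); rewrite ?mulr0 ?addr0.
have [g0|g0] := eqVneq (shift f) 0.
  have fE : f = gmon f@_p p.
    apply/malgP => a; rewrite mcoeff_gmon.
    have [<-//|pa] := eqVneq p a.
    have := shiftE f (a - 1); rewrite g0 mcoeff0 subrK.
    have -> : (a - 1 == p - 1) = false by lia.
    by move=> <-.
  have fp0 : f@_p != 0.
    by apply: contraNneq f0 => fp0; rewrite fE fp0 gmon0.
  exists p; rewrite (_ : gmon 1 p = (f@_p)^-1 *: f); first exact: idealZ.
  by rewrite [X in _ *: X]fE gmonZ mulVf.
have gsupp a : (shift f)@_a != 0 -> p <= a < p + d%:Z.
  rewrite shiftE; have [_|ap] := eqVneq a (p - 1); first by rewrite eqxx.
  by move=> /supp; lia.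
have [Ig|nIg] := pselect (I (shift f)); first exact: IHd Ig g0 gsupp.
(* This keeps p itself inside the shorter window, as needed for [u] below. *)
have d0 : (0 < d)%N.
  rewrite lt0n; apply: contraNneq g0 => d0.
  apply/eqP/malgP => a; rewrite mcoeff0; apply/eqP/contraT => /gsupp.
  by rewrite d0; lia.
pose S : set A1 := (add_set I
  [set w : A1 | forall a, w@_a != 0 -> p < a < p + d%:Z])%classic.
have subS : subspace (k := k) (W := laurent k) S.
  split.
    exists 0; first exact: idI.1.1.
    by exists 0; rewrite ?addr0 // => a; rewrite mcoeff0 eqxx.
  move=> c _ _ [u1 Iu1 [w1 Ww1 <-]] [u2 Iu2 [w2 Ww2 <-]].
  exists (c *: u1 + u2); first exact: idI.1.2.
  exists (c *: w1 + w2); last by rewrite scalerDr addrACA.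
  move=> a; rewrite mcoeffD mcoeffZ.
  have [->|/Ww1 //] := eqVneq w1@_a 0.
  by rewrite mulr0 add0r => /Ww2.
(* If t^p = u + w, then u is in I, has coefficient 1 at p and fits the shorter window. *)
have [[u Iu [w Ww E]]|nS] := pselect (S (gmon 1 p)).
  have uE : u = gmon 1 p - w by rewrite -E addrK.
  apply: (IHd p u Iu).
    apply/eqP => /malgP /(_ p); rewrite uE mcoeffB mcoeff_gmon eqxx mcoeff0.
    have [->|/Ww] := eqVneq w@_p 0; last by lia.
    by apply/eqP; rewrite subr0 oner_neq0.
  move=> a; rewrite uE mcoeffB mcoeff_gmon.
  have [<- _|_] := eqVneq p a; first by lia.
  by rewrite sub0r oppr_eq0 => /Ww; lia.
have [phi [philin phiS phi1]] := separating_functional subS nS.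
have [psi [psilin psiI psi1]] := separating_functional idI.1 nIg.
have phiI u : I u -> phi u = 0.
  move=> Iu; apply: phiS; exists u => //.
  by exists 0; rewrite ?addr0 // => a; rewrite mcoeff0 eqxx.
have phiW (a : int) : p < a < p + d%:Z -> phi (gmon 1 a) = 0.
  move=> pa; apply: phiS; exists 0; first exact: idI.1.1.
  exists (gmon 1 a); last by rewrite add0r.
  by move=> b; rewrite mcoeff_gmon; have [<-|_] := eqVneq a b; rewrite ?eqxx.
have br0 := (pairing_ideal philin psilin (gmon 1 (p - 1)) idI phiI psiI If).1.
pose L (h : A1) : k^o := pairing phi psi (br (gmon 1 (p - 1)) h).
(* For t^a in the window, the first two terms of [laurent_brU] give the two summands; in later terms
   [phi] meets exponents strictly between p and p + d and vanishes. *)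
pose L' (h : A1) : k^o :=
  lambda * (phi (gmon 1 (p - 1)) * psi h + psi (shift h)).
have LL' : L f = L' f.
  apply: eq_linear_msupp.
  - by move=> c u v; rewrite /L laurent_br_bilinear.2 pairing_linear.
  - move=> c u v; rewrite /L' shift_lin !psilin.
    have E (b x1 x2 y1 y2 : k) : lambda * (b * (c * x1 + x2) + (c * y1 + y2))
      = c * (lambda * (b * x1 + y1)) + lambda * (b * x2 + y2) by ring.
    exact: E.
  move=> a /supp pa; rewrite /L /L'.
  pose i := `|a - p|%N; have aE : a = p - 1 + i.+1%:Z by rewrite /i; lia.
  have id : (i <= d)%N by rewrite /i; lia.
  rewrite aE pairing_laurent_brU big_nat_recl // addr0 subr0.
  (* For a = p there is no second term, matching the value 0 of [shift] at t^p. *)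
  congr (_ * (_ + _)); rewrite shiftU; case: i id aE => [|i] id aE.
    rewrite big_geq // (_ : p - 1 + 1%:Z = p) ?subrK // eqxx.
    by rewrite psiI //; exact: idI.1.1.
  have -> : (p - 1 + i.+2%:Z == p) = false by lia.
  rewrite big_nat_recl // subrK phi1 mul1r big_nat big1 ?addr0.
    by congr (psi (gmon 1 _)); lia.
  by move=> l /andP[_ li]; rewrite phiW ?mul0r //; lia.
move: LL'; rewrite /L br0 /L' (psiI _ If) psi1 mulr0 add0r mulr1 => /esym/eqP.
by rewrite (negPf lambda0).
Qed.

End Ideal.

End LaurentBracket.

Unset Implicit Arguments.

Theorem corollary3p4 (k : fieldType) (lambda : k) (hlambda : lambda != 0) :
  is_simple_double_lie (laurent3 k) (@laurent_br k lambda) lambda.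
Proof.
split.
- split; first exact: laurent_br_bilinear.
    by move=> f g; rewrite swap12_2E; exact: laurent_br_antisym.
  exact: laurent_br_jacobi.
(* The bracket of 1 and t is [lambda] times the monomial y. *)
- exists (gmon 1 0), (gmon 1 (0 + 1%:Z)); rewrite laurent_brU big_nat1.
  move=> /malgP /(_ (0, 1)) /eqP.
  by rewrite mcoeffZ mcoeff_gmon eqxx mcoeff0 mulr1 (negPf hlambda).
move=> I idI.
have [[f If f0]|I0] := pselect (exists2 f, I f & f != 0); last first.
  left; apply/seteqP; split=> [f If|_ ->] /=; last exact: idI.1.1.
  by apply: contrapT => /eqP f0; apply: I0; exists f.
right.
have [p [d supp]] : exists (p : int) (d : nat),
    forall a, f@_a != 0 -> p <= a < p + d%:Z.
  pose N := \max_(a <- msupp f) `|a|%N.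
  exists (- N%:Z), (N + N).+1 => a; rewrite mcoeff_neq0 => fa.
  have : (`|a| <= N)%N by apply: leq_bigmax_seq.
  lia.
have [a Ia] := ideal_has_gmon idI hlambda If f0 supp.
exact (ideal_full idI hlambda Ia).
Qed.
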